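(* Let $A \in \mathbb{R}^{m\times m}$ be a nonsingular matrix, $K=A\mathbb{R}^m_+$ the corresponding simplicial cone, and $z\in\mathbb{R}^m$ arbitrary. Let $C:=\left(A^\top A+I\right)^{-1}\left(A^\top A-I\right)$. Then, for any starting point $x_0\in\mathbb{R}^m$, the sequence $\{x_k\}$ given by $$\left(A^\top A+I\right)x_{k+1}=-\left(A^\top A-I\right)|x_k| + 2A^\top z,\qquad k=0,1,2,\ldots,$$ is well defined and converges to the unique solution $u\in\mathbb{R}^m$ of the equation $$\left(A^\top A+I\right)x+\left(A^\top A-I\right)|x| = 2A^\top z,$$ one has $P_K(z)=Au^+$, and the following error bound holds: $$\|u-x_k\|\le \frac{\|C\|}{1-\|C\|}\,\|x_k-x_{k-1}\|,\qquad k=1,2,\ldots.$$ Moreover, $\{x_k\}$ converges linearly to $u$ in the sense that $$\|u-x_{k+1}\|\le \|C\|\,\|u-x_k\|,\qquad k=0,1,2,\ldots.$$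
   Context: $\mathbb{R}^m$ carries the canonical scalar product $\langle\cdot,\cdot\rangle$ and the induced Euclidean norm $\|\cdot\|$. For $M\in\mathbb{R}^{m\times m}$, $\|M\|:=\max\{\|Mx\| : x\in\mathbb{R}^m,\ \|x\|=1\}$. $I$ is the $m\times m$ identity matrix. For $x=(x^1,\dots,x^m)\in\mathbb{R}^m$, $x^+:=(\max\{x^1,0\},\dots,\max\{x^m,0\})$ and $|x|:=(|x^1|,\dots,|x^m|)$. $\mathbb{R}^m_+$ is the nonnegative orthant, the set of vectors with all components $\ge 0$. For a nonsingular $A\in\mathbb{R}^{m\times m}$, the simplicial cone is $K=A\mathbb{R}^m_+:=\{Ax : x\in\mathbb{R}^m_+\}$. $P_K(z):=\operatorname{argmin}\{\|z-y\| : y\in K\}$ is the projection of $z$ onto $K$. The matrix $A^\top A+I$ is nonsingular, since $A^\top A$ is symmetric positive definite, so $C$ makes sense; the sequence being well defined means that each $x_{k+1}$ is uniquely determined by $x_k$. *)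

(* Defs.v *)
From mathcomp Require Import all_boot all_order all_algebra.
From mathcomp Require Import all_classical all_reals all_analysis.

Set Implicit Arguments.
Unset Strict Implicit.
Unset Printing Implicit Defensive.

Import Order.TTheory GRing.Theory Num.Theory.
Import numFieldNormedType.Exports.

Local Open Scope classical_set_scope.
Local Open Scope ring_scope.

(* The library's norm on matrices is the maximum norm, so the canonical scalar
   product and the Euclidean norm on R^m are introduced here. *)
Definition dotp (R : realType) (m : nat) (x y : 'cV[R]_m) : R :=
  \sum_i x i 0 * y i 0.

Definition enorm (R : realType) (m : nat) (x : 'cV[R]_m) : R :=
  Num.sqrt (dotp x x).

(* For m > 0 this supremum is a maximum, see [opnorm_max] below. *)
Definition opnorm (R : realType) (m : nat) (M : 'M[R]_m) : R :=
  sup [set enorm (M *m x) | x in [set x : 'cV[R]_m | enorm x = 1]].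

Definition posv (R : realType) (m : nat) (x : 'cV[R]_m) : 'cV[R]_m :=
  \col_i Num.max (x i 0) 0.

Definition absv (R : realType) (m : nat) (x : 'cV[R]_m) : 'cV[R]_m :=
  \col_i `|x i 0|.

Definition nonneg_orthant (R : realType) (m : nat) : set 'cV[R]_m :=
  [set x | forall i, 0 <= x i 0].

Definition simplicial_cone (R : realType) (m : nat) (A : 'M[R]_m) :
    set 'cV[R]_m :=
  [set A *m x | x in @nonneg_orthant R m].

(* The set of all minimizers; [metric_proj K z = [set p]] says that p is the
   unique nearest point of K to z. *)
Definition metric_proj (R : realType) (m : nat) (K : set 'cV[R]_m)
    (z : 'cV[R]_m) : set 'cV[R]_m :=
  [set p | K p /\ forall y, K y -> enorm (z - p) <= enorm (z - y)].

(* [invmx] is the genuine inverse: A^T A + I is positive definite. *)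
Definition Cmx (R : realType) (m : nat) (A : 'M[R]_m) : 'M[R]_m :=
  invmx (A^T *m A + 1%:M) *m (A^T *m A - 1%:M).

Definition solves_ave (R : realType) (m : nat) (A : 'M[R]_m) (z x : 'cV[R]_m) :
    Prop :=
  (A^T *m A + 1%:M) *m x + (A^T *m A - 1%:M) *m absv x = 2 *: (A^T *m z).

Definition iter_step (R : realType) (m : nat) (A : 'M[R]_m)
    (z x y : 'cV[R]_m) : Prop :=
  (A^T *m A + 1%:M) *m y = - ((A^T *m A - 1%:M) *m absv x) + 2 *: (A^T *m z).

Definition iter_seq (R : realType) (m : nat) (A : 'M[R]_m)
    (z x0 : 'cV[R]_m) (x : nat -> 'cV[R]_m) : Prop :=
  x 0%N = x0 /\ forall k, iter_step A z (x k) (x k.+1).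

Lemma enorm_mul_continuous (R : realType) (m : nat) (M : 'M[R]_m) :
  continuous (fun v : 'rV[R]_m => enorm (M *m v^T)).
Proof.
have csum (n : nat) (F : 'I_n -> 'rV[R]_m -> R) :
    (forall i, continuous (F i)) -> continuous (fun v => \sum_i F i v).
  move=> cF; apply: continuous_big => [|i _]; last exact: cF.
  move=> [a b]; apply: (@cvgD _ _ _ _ _ fst snd a b).
    exact: cvg_fst.
  exact: cvg_snd.
have cM i : continuous (fun v : 'rV[R]_m => (M *m v^T) i 0).
  have -> : (fun v : 'rV[R]_m => (M *m v^T) i 0) =
            (fun v : 'rV[R]_m => \sum_j M i j * v 0 j).
    by apply/funext => v; rewrite mxE; apply: eq_bigr => j _; rewrite mxE.
  by apply: csum => j v; apply: continuousM; [exact: cst_continuous |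
    exact: coord_continuous].
move=> v; rewrite /enorm /dotp.
apply: (@continuous_comp _ _ _ (fun v : 'rV[R]_m =>
  \sum_i (M *m v^T) i 0 * (M *m v^T) i 0) Num.sqrt).
  by apply: csum => i w; apply: continuousM; exact: cM.
exact: sqrt_continuous.
Qed.

Lemma opnorm_max (R : realType) (m : nat) (M : 'M[R]_m) : (0 < m)%N ->
  (exists2 x : 'cV[R]_m, enorm x = 1 & enorm (M *m x) = opnorm M) /\
  (forall x : 'cV[R]_m, enorm x = 1 -> enorm (M *m x) <= opnorm M).
Proof.
move=> m0.
pose S := [set v : 'rV[R]_m | enorm v^T = 1].
have nc : continuous (fun v : 'rV[R]_m => enorm v^T).
  rewrite (_ : (fun _ => _) = (fun v : 'rV[R]_m => enorm (1%:M *m v^T))).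
    exact: enorm_mul_continuous.
  by apply/funext => v; rewrite mul1mx.
have S0 : S !=set0.
  exists (delta_mx 0 (Ordinal m0)); rewrite /S /= /enorm /dotp.
  rewrite (bigD1 (Ordinal m0)) //= !mxE !eqxx /= mulr1 big1 ?addr0 ?sqrtr1//.
  by move=> i /negPf ni; rewrite !mxE ni andbF mulr0.
have cS : compact S.
  apply: bounded_closed_compact.
    exists 1; split => // r r1 v Sv.
    apply: le_trans (ltW r1).
    change (mx_norm v <= 1); rewrite mx_normrE.
    apply/bigmax_leP; split => //= -[i j] _.
    have v1 : \sum_k v 0 k ^+ 2 = 1.
      move: Sv => /(congr1 (fun t => t ^+ 2)); rewrite expr1n sqr_sqrtr.
        by move=> <-; apply: eq_bigr => k _; rewrite !mxE expr2.
      by apply: sumr_ge0 => k _; rewrite -expr2 sqr_ge0.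
    rewrite (ord1 i) -(@expr_le1 _ 2)// real_normK ?num_real// -v1.
    by rewrite (bigD1 j)//= lerDl sumr_ge0// => k _; rewrite sqr_ge0.
  have -> : S = (fun v : 'rV[R]_m => enorm v^T) @^-1` [set 1] by [].
  by apply: preimage_closed => [v _|]; [exact: nc | exact: closed_eq].
have [v Sv vmax] := EVT_max_rV S0 cS
  (continuous_subspaceT (@enorm_mul_continuous R m M)).
have ub x : enorm x = 1 -> enorm (M *m x) <= enorm (M *m v^T).
  by move=> x1; have := vmax x^T; rewrite trmxK; apply; rewrite inE /S/= trmxK.
have E : opnorm M = enorm (M *m v^T).
  apply/eqP; rewrite eq_le; apply/andP; split.
    apply: ge_sup; last by move=> _ [x x1 <-]; exact: ub.
    by exists (enorm (M *m v^T)); exists v^T => //; move: Sv; rewrite inE.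
  apply: ub_le_sup; last by exists v^T => //; move: Sv; rewrite inE.
  by exists (enorm (M *m v^T)) => _ [x x1 <-]; exact: ub.
split; last by rewrite E.
by exists v^T; rewrite ?E//; move: Sv; rewrite inE.
Qed.

(* Main.v *)
From HB Require Import structures.
Require Import Defs.
From mathcomp Require Import all_boot all_order all_algebra.
From mathcomp Require Import all_classical all_reals all_analysis.
From mathcomp Require Import ring lra.
Import Order.TTheory GRing.Theory Num.Theory.
Import numFieldNormedType.Exports.
Local Open Scope classical_set_scope.
Local Open Scope ring_scope.

Set Implicit Arguments.
Unset Strict Implicit.
Unset Printing Implicit Defensive.

(** Write S for the Gram matrix A^T A. Solving the recurrence for its new term
gives x_(k+1) = f(x_k) with f(x) = - C |x| + 2 (S + I)^-1 A^T z, and a solution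
of the equation is exactly a fixed point of f. Taking absolute values
componentwise does not increase Euclidean distances, so f is Lipschitz with
constant q = ||C||, and everything about the iteration follows from q < 1.

That inequality is [opnorm_Cmx_lt1]. If y = C x, then (S + I) y = (S - I) x,
that is, S (x - y) = x + y. Pairing this with x - y yields
||A (x - y)||^2 = ||x||^2 - ||y||^2, so ||y|| <= ||x||. As A is nonsingular,
equality would force x = y, hence x + y = 0 and x = 0. The supremum that defines
||C|| is attained on the unit sphere, hence it is smaller than 1.

The fixed point u comes from Banach's theorem, applied in the maximum norm. For
that norm f itself need not be a contraction; but the two norms are equivalent,
so a large iterate of f contracts the maximum norm, and its unique
fixed point is fixed by f as well ([enorm_contraction_fixpoint]).

The projection formula is [metric_proj_simplicial_cone]. Since u = u^+ - u^-
and |u| = u^+ + u^-, the equation says A^T (z - A u^+) = - u^-. As u^- is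
nonnegative and orthogonal to u^+, this is the variational inequality that
characterizes A u^+ as the nearest point of the cone to z. *)

(** * The Euclidean inner product and norm *)

Lemma dotpC (R : realType) (m : nat) (x y : 'cV[R]_m) : dotp x y = dotp y x.
Proof. by apply: eq_bigr => i _; rewrite mulrC. Qed.

Lemma dotpDl (R : realType) (m : nat) (x y w : 'cV[R]_m) :
  dotp (x + y) w = dotp x w + dotp y w.
Proof.
by rewrite /dotp -big_split; apply: eq_bigr => i _; rewrite /= mxE mulrDl.
Qed.

Lemma dotpZl (R : realType) (m : nat) (a : R) (x w : 'cV[R]_m) :
  dotp (a *: x) w = a * dotp x w.
Proof.
by rewrite /dotp big_distrr; apply: eq_bigr => i _; rewrite /= mxE mulrA.
Qed.

Lemma dotpNl (R : realType) (m : nat) (x w : 'cV[R]_m) :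
  dotp (- x) w = - dotp x w.
Proof. by rewrite -scaleN1r dotpZl mulN1r. Qed.

Lemma dotpBl (R : realType) (m : nat) (x y w : 'cV[R]_m) :
  dotp (x - y) w = dotp x w - dotp y w.
Proof. by rewrite dotpDl dotpNl. Qed.

Lemma dotpBr (R : realType) (m : nat) (x y w : 'cV[R]_m) :
  dotp w (x - y) = dotp w x - dotp w y.
Proof. by rewrite dotpC dotpBl !(dotpC w). Qed.

Lemma dotpDr (R : realType) (m : nat) (x y w : 'cV[R]_m) :
  dotp w (x + y) = dotp w x + dotp w y.
Proof. by rewrite dotpC dotpDl !(dotpC w). Qed.

Lemma dotpZr (R : realType) (m : nat) (a : R) (x w : 'cV[R]_m) :
  dotp w (a *: x) = a * dotp w x.
Proof. by rewrite dotpC dotpZl (dotpC w). Qed.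

Lemma dotp_addadd (R : realType) (m : nat) (x y : 'cV[R]_m) :
  dotp (x + y) (x + y) = dotp x x + 2 * dotp x y + dotp y y.
Proof. by rewrite dotpDl !dotpDr (dotpC y x); ring. Qed.

Lemma dotp_ge0 (R : realType) (m : nat) (x : 'cV[R]_m) : 0 <= dotp x x.
Proof. by apply: sumr_ge0 => i _; rewrite -expr2 sqr_ge0. Qed.

Lemma dotp_eq0 (R : realType) (m : nat) (x : 'cV[R]_m) :
  dotp x x = 0 -> x = 0.
Proof.
move=> /psumr_eq0P => x0; apply/colP => i; rewrite mxE.
have /eqP : x i 0 * x i 0 = 0.
  by apply: x0 => // j _; rewrite -expr2 sqr_ge0.
by rewrite mulf_eq0 orbb => /eqP.
Qed.

Lemma dotp_mulmxl (R : realType) (m : nat) (M : 'M[R]_m) (x y : 'cV[R]_m) :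
  dotp (M *m x) y = dotp x (M^T *m y).
Proof.
have dotpE (v w : 'cV[R]_m) : dotp v w = (v^T *m w) 0 0.
  by rewrite mxE; apply: eq_bigr => i _; rewrite mxE.
by rewrite !dotpE trmx_mul mulmxA.
Qed.

Lemma enorm_ge0 (R : realType) (m : nat) (x : 'cV[R]_m) : 0 <= enorm x.
Proof. exact: sqrtr_ge0. Qed.

Lemma sqr_enorm (R : realType) (m : nat) (x : 'cV[R]_m) :
  enorm x ^+ 2 = dotp x x.
Proof. by rewrite sqr_sqrtr// dotp_ge0. Qed.

Lemma enorm_eq0 (R : realType) (m : nat) (x : 'cV[R]_m) : enorm x = 0 -> x = 0.
Proof. by move=> x0; apply: dotp_eq0; rewrite -sqr_enorm x0 expr0n. Qed.

Lemma ler_enorm (R : realType) (m n : nat) (x : 'cV[R]_m) (y : 'cV[R]_n) :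
  (enorm x <= enorm y) = (dotp x x <= dotp y y).
Proof. by rewrite ler_sqrt ?dotp_ge0. Qed.

Lemma enormZ (R : realType) (m : nat) (a : R) (x : 'cV[R]_m) :
  enorm (a *: x) = `|a| * enorm x.
Proof.
by rewrite /enorm dotpZl dotpZr mulrA -expr2 sqrtrM ?sqr_ge0// sqrtr_sqr.
Qed.

Lemma enormN (R : realType) (m : nat) (x : 'cV[R]_m) : enorm (- x) = enorm x.
Proof. by rewrite -scaleN1r enormZ normrN1 mul1r. Qed.

(** The Cauchy-Schwarz inequality: the norms serve as weights that make the
expansion of || ||y|| x - ||x|| y ||^2 >= 0 a multiple of the claim. *)
Lemma dotp_le_enorm (R : realType) (m : nat) (x y : 'cV[R]_m) :
  dotp x y <= enorm x * enorm y.
Proof.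
have [/enorm_eq0 -> | x0] := eqVneq (enorm x) 0.
  by rewrite -(scale0r 0) dotpZl mul0r mulr_ge0// enorm_ge0.
have [/enorm_eq0 -> | y0] := eqVneq (enorm y) 0.
  by rewrite -(scale0r 0) dotpZr mul0r mulr_ge0// enorm_ge0.
have xy0 : 0 < enorm x * enorm y.
  by rewrite mulr_gt0// lt_neqAle enorm_ge0 andbT eq_sym.
have := dotp_ge0 (enorm y *: x - enorm x *: y).
rewrite dotpBl !dotpBr !dotpZl !dotpZr -!sqr_enorm (dotpC y x) => h.
by rewrite -(ler_pM2l xy0); nra.
Qed.

Lemma ler_enormD (R : realType) (m : nat) (x y : 'cV[R]_m) :
  enorm (x + y) <= enorm x + enorm y.
Proof.
rewrite -(@ler_sqr R) ?nnegrE ?addr_ge0 ?enorm_ge0//.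
rewrite sqr_enorm dotp_addadd -!sqr_enorm.
by have := dotp_le_enorm x y; lra.
Qed.

(** The operator norm is a supremum over the unit sphere; homogeneity carries
the bound over to all vectors. *)
Lemma enorm_mulmx_le (R : realType) (m : nat) (M : 'M[R]_m) (x : 'cV[R]_m) :
  (0 < m)%N -> enorm (M *m x) <= opnorm M * enorm x.
Proof.
move=> m0; have [_ Mle] := opnorm_max M m0.
have [/enorm_eq0 -> | x0] := eqVneq (enorm x) 0.
  by rewrite mulmx0 -(scale0r 0) enormZ normr0 !mul0r mulr0.
have xgt0 : 0 < enorm x by rewrite lt_neqAle enorm_ge0 andbT eq_sym.
have := Mle ((enorm x)^-1 *: x).
rewrite -scalemxAr !enormZ normfV ger0_norm ?enorm_ge0// mulVf// => /(_ erefl).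
by rewrite ler_pdivrMl// mulrC.
Qed.

Lemma opnorm_ge0 (R : realType) (m : nat) (M : 'M[R]_m) :
  (0 < m)%N -> 0 <= opnorm M.
Proof.
by move=> m0; have [[x _ <-] _] := opnorm_max M m0; exact: enorm_ge0.
Qed.

Lemma enorm_absvB (R : realType) (m : nat) (x y : 'cV[R]_m) :
  enorm (absv x - absv y) <= enorm (x - y).
Proof.
rewrite ler_enorm; apply: ler_sum => i _; rewrite !mxE -!expr2.
by rewrite -[leLHS]real_normK ?num_real// -[leRHS]real_normK ?num_real//
  lerXn2r ?nnegrE// ler_dist_dist.
Qed.

(** * Fixed points of Euclidean contractions *)

Lemma mx_norm_le_enorm (R : realType) (m : nat) (x : 'cV[R]_m) :
  `|x| <= enorm x.
Proof.
change (mx_norm x <= enorm x); rewrite mx_normrE.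
apply/bigmax_leP; split=> [|[i j] _ /=]; first exact: enorm_ge0.
rewrite (ord1 j) -(@ler_sqr R) ?nnegrE ?enorm_ge0//.
rewrite sqr_enorm real_normK ?num_real//.
rewrite /dotp (bigD1 i)//= expr2 lerDl sumr_ge0// => k _.
by rewrite -expr2 sqr_ge0.
Qed.

Lemma enorm_le_mx_norm (R : realType) (m : nat) (x : 'cV[R]_m) :
  enorm x <= Num.sqrt m%:R * `|x|.
Proof.
rewrite -(@ler_sqr R) ?nnegrE ?enorm_ge0 ?mulr_ge0 ?sqrtr_ge0//.
rewrite sqr_enorm exprMn sqr_sqrtr ?ler0n// mulr_natl.
rewrite -[X in _ *+ X]card_ord -sumr_const; apply: ler_sum => i _.
rewrite -expr2 -[leLHS]real_normK ?num_real// lerXn2r ?nnegrE//.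
change (`|x i 0| <= mx_norm x); rewrite mx_normrE.
exact: (le_bigmax _ (fun ij => `|x ij.1 ij.2|) (i, 0)).
Qed.

(** Matrices are both a complete uniform space and a normed module; this joins
the two structures, as Banach's theorem needs a complete normed module. *)
HB.instance Definition _ (R : realType) (m n : nat) :=
  Complete.on 'M[R]_(m, n).

Lemma enorm_contraction_iter (R : realType) (m : nat) (q : R)
    (f : 'cV[R]_m -> 'cV[R]_m) (n : nat) (x y : 'cV[R]_m) : 0 <= q ->
  (forall x y, enorm (f x - f y) <= q * enorm (x - y)) ->
  enorm (iter n f x - iter n f y) <= q ^+ n * enorm (x - y).
Proof.
move=> q0 fq; elim: n => [|n IH]; first by rewrite mul1r.
by rewrite (le_trans (fq _ _))// exprS -mulrA ler_wpM2l.
Qed.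

(** Banach's theorem for the Euclidean norm, through the maximum norm. Passing
between the two norms costs a factor sqrt m, so the N-th iterate contracts the
maximum norm as soon as q^N sqrt m < 1. If u is the fixed point of that iterate,
so is f u, and uniqueness gives f u = u. *)
Lemma enorm_contraction_fixpoint (R : realType) (m : nat) (q : R)
    (f : 'cV[R]_m -> 'cV[R]_m) : 0 <= q -> q < 1 ->
  (forall x y, enorm (f x - f y) <= q * enorm (x - y)) ->
  exists u, f u = u.
Proof.
move=> q0 q1 fq.
have [N qN] : exists N, q ^+ N * Num.sqrt m%:R < 1.
  have qm0 : Num.sqrt m%:R * q ^+ n @[n --> \oo] --> (0 : R).
    by apply: cvg_geometric; rewrite ger0_norm.
  have /cvgr_lt/(_ _ ltr01)[N _ /(_ N (leqnn N))] := qm0.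
  by exists N; rewrite mulrC.
have qN0 : 0 <= q ^+ N * Num.sqrt m%:R.
  by rewrite mulr_ge0 ?exprn_ge0 ?sqrtr_ge0.
pose g : {fun [set: 'cV[R]_m] >-> [set: 'cV[R]_m]} :=
  [fun of totalfun (iter N f)].
have gq : is_contraction g.
  exists (NngNum qN0); split=> //= -[x y] _ /=.
  rewrite (le_trans (mx_norm_le_enorm _))//.
  rewrite (le_trans (enorm_contraction_iter N x y q0 fq))// -mulrA.
  by rewrite ler_wpM2l ?exprn_ge0// enorm_le_mx_norm.
have [u _ ug] : exists2 u, setT u & u = g u.
  by apply: banach_fixed_point => //; exists 0.
exists u; apply/(contraction_fixpoint_unique gq) => //.
rewrite {1}ug; change (f (iter N f u) = iter N f (f u)).
by rewrite -iterSr.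
Qed.

(** * The matrix C and the iteration *)

(** If (A^T A + I) v = 0, then pairing with v gives ||A v||^2 + ||v||^2 = 0, so
the kernel is trivial. *)
Lemma gram_p1_unitmx (R : realType) (m : nat) (A : 'M[R]_m) :
  A^T *m A + 1%:M \in unitmx.
Proof.
rewrite -unitmx_tr -row_free_unit; apply: inj_row_free => v vS.
have Sv : (A^T *m A + 1%:M) *m v^T = 0.
  by apply: trmx_inj; rewrite trmx_mul trmxK trmx0.
suff /(congr1 trmx) : v^T = 0 by rewrite trmxK trmx0.
apply: dotp_eq0.
have : dotp v^T ((A^T *m A + 1%:M) *m v^T) = 0.
  by rewrite Sv -(scale0r 0) dotpZr mul0r.
rewrite mulmxDl mul1mx dotpDr -mulmxA -dotp_mulmxl.
by have := dotp_ge0 (A *m v^T); have := dotp_ge0 v^T; lra.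
Qed.

(** With y = C x one has A^T A (x - y) = x + y, and pairing with x - y turns
this into ||A (x - y)||^2 = ||x||^2 - ||y||^2. *)
Lemma enorm_Cmx_lt (R : realType) (m : nat) (A : 'M[R]_m) (x : 'cV[R]_m) :
  A \in unitmx -> x != 0 -> enorm (Cmx A *m x) < enorm x.
Proof.
move=> uA x0; set y := Cmx A *m x.
have Sy : (A^T *m A + 1%:M) *m y = (A^T *m A - 1%:M) *m x.
  by rewrite /y /Cmx -mulmxA mulKVmx ?gram_p1_unitmx.
have Sxy : A^T *m A *m (x - y) = x + y.
  move: Sy; rewrite mulmxDl mulmxBl !mul1mx mulmxBr => /eqP.
  by rewrite -subr_eq0 => /eqP Sy; apply/eqP; rewrite -subr_eq0 -oppr_eq0 -Sy;
    apply/eqP/colP => i; rewrite !mxE; ring.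
have E : dotp (A *m (x - y)) (A *m (x - y)) = dotp x x - dotp y y.
  by rewrite dotp_mulmxl mulmxA Sxy dotpBl !dotpDr (dotpC y x); ring.
rewrite ltNge ler_enorm; apply/negP => xy.
have /dotp_eq0 Axy0 : dotp (A *m (x - y)) (A *m (x - y)) = 0.
  by have := dotp_ge0 (A *m (x - y)); lra.
have xyD : x + y = 0 by rewrite -Sxy -mulmxA Axy0 mulmx0.
have xyB : x - y = 0 by rewrite -(mulKmx uA (x - y)) Axy0 mulmx0.
move/eqP: x0; apply; apply/colP => i.
by have := congr1 (fun v : 'cV[R]_m => v i 0) xyD;
  have := congr1 (fun v : 'cV[R]_m => v i 0) xyB; rewrite !mxE; lra.
Qed.

(** The strict inequality survives the supremum because the supremum is
attained. *)
Lemma opnorm_Cmx_lt1 (R : realType) (m : nat) (A : 'M[R]_m) :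
  (0 < m)%N -> A \in unitmx -> opnorm (Cmx A) < 1.
Proof.
move=> m0 uA; have [[x x1 <-] _] := opnorm_max (Cmx A) m0.
rewrite -x1; apply: enorm_Cmx_lt => //; apply/eqP => x0; move: x1.
by rewrite x0 -(scale0r 0) enormZ normr0 mul0r => /esym/eqP; rewrite oner_eq0.
Qed.

Lemma iter_step_eq (R : realType) (m : nat) (A : 'M[R]_m) (z x y : 'cV[R]_m) :
  iter_step A z x y <->
  y = invmx (A^T *m A + 1%:M) *m
        (- ((A^T *m A - 1%:M) *m absv x) + 2 *: (A^T *m z)).
Proof.
rewrite /iter_step; split=> [<-|->].
  by rewrite mulKmx ?gram_p1_unitmx.
by rewrite mulKVmx ?gram_p1_unitmx.
Qed.

Lemma iter_step_contraction (R : realType) (m : nat) (A : 'M[R]_m)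
    (z x x' y y' : 'cV[R]_m) : (0 < m)%N ->
  iter_step A z x y -> iter_step A z x' y' ->
  enorm (y - y') <= opnorm (Cmx A) * enorm (x - x').
Proof.
move=> m0 /iter_step_eq -> /iter_step_eq ->.
rewrite -mulmxBr opprD addrACA subrr addr0 -opprD -mulmxBr mulmxN.
rewrite mulmxA -/(Cmx A) enormN.
apply: le_trans (enorm_mulmx_le _ _ m0) _.
by rewrite ler_wpM2l ?opnorm_ge0// enorm_absvB.
Qed.

Lemma solves_ave_iter_step (R : realType) (m : nat) (A : 'M[R]_m)
    (z x : 'cV[R]_m) : solves_ave A z x <-> iter_step A z x x.
Proof.
rewrite /solves_ave /iter_step; split=> [<-|->].
  by rewrite addrCA addNr addr0.
by rewrite addrAC addNr add0r.
Qed.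

(** * The projection onto the cone *)

(** With p = A u^+, the equation reads A^T (z - p) = - u^-. For y = A x with
x >= 0 this gives <z - p, p - y> = <u^-, x> - <u^-, u^+> = <u^-, x> >= 0, hence
||z - p||^2 + ||p - y||^2 <= ||z - y||^2, which makes p a nearest point and the
only one. *)
Lemma metric_proj_simplicial_cone (R : realType) (m : nat) (A : 'M[R]_m)
    (z u : 'cV[R]_m) : solves_ave A z u ->
  metric_proj (simplicial_cone A) z = [set A *m posv u].
Proof.
move=> ave; set p := A *m posv u.
pose neg : 'cV[R]_m := posv (- u).
have grad : A^T *m (z - p) = - neg.
  have uE : u = posv u - neg.
    apply/colP => i; rewrite !mxE.
    by case: (leP (u i 0) 0); case: (leP (- u i 0) 0); lra.
  have absE : absv u = posv u + neg.
    apply/colP => i; rewrite !mxE.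
    by case: (ler0P (u i 0)); case: (leP (u i 0) 0);
      case: (leP (- u i 0) 0); lra.
  move: ave; rewrite /solves_ave absE {1}uE mulmxDl mulmxBl !mul1mx.
  rewrite mulmxBr mulmxDr => ave.
  have {}ave : 2 *: (A^T *m p - neg) = 2 *: (A^T *m z).
    by rewrite -ave /p mulmxA; apply/colP => i; rewrite !mxE; ring.
  by rewrite mulmxBr -(scalerI _ ave) ?pnatr_eq0// addrAC subrr add0r.
have pK : simplicial_cone A p.
  by exists (posv u) => // i; rewrite mxE le_max lexx orbT.
have pyth y : simplicial_cone A y ->
    dotp (z - p) (z - p) + dotp (p - y) (p - y) <= dotp (z - y) (z - y).
  move=> [x x0 <-].
  have -> : z - A *m x = (z - p) + (p - A *m x) by rewrite addrA subrK.
  set a := z - p; set b := p - A *m x.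
  rewrite [leRHS]dotp_addadd.
  suff : 0 <= dotp a b by lra.
  rewrite dotpC /b -mulmxBr dotp_mulmxl grad.
  apply: sumr_ge0 => i _; rewrite !mxE.
  by have := x0 i; case: (leP (u i 0) 0); case: (leP (- u i 0) 0); nra.
apply/seteqP; split=> [y [yK ymin] | _ ->] /=.
  have := ymin _ pK; rewrite ler_enorm => yp; have := pyth y yK => py.
  apply/eqP; rewrite eq_sym -subr_eq0; apply/eqP/dotp_eq0.
  by have := dotp_ge0 (p - y); lra.
split=> // y yK; rewrite ler_enorm.
by have := pyth y yK; have := dotp_ge0 (p - y); lra.
Qed.

(** * Convergence *)

Unset Implicit Arguments.

Theorem theorem4 (R : realType) (m : nat) (A : 'M[R]_m) (z : 'cV[R]_m) :
  (0 < m)%N -> A \in unitmx ->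
  (forall x : 'cV[R]_m, exists! y : 'cV[R]_m, iter_step A z x y) /\
  exists u : 'cV[R]_m,
    [/\ solves_ave A z u,
        forall v : 'cV[R]_m, solves_ave A z v -> v = u,
        metric_proj (simplicial_cone A) z = [set A *m posv u],
        opnorm (Cmx A) < 1 &
        forall x0 : 'cV[R]_m,
          (exists x : nat -> 'cV[R]_m, iter_seq A z x0 x) /\
          forall x : nat -> 'cV[R]_m, iter_seq A z x0 x ->
          [/\ enorm (u - x k) @[k --> \oo] --> (0 : R),
              forall k : nat, enorm (u - x k.+1) <=
                opnorm (Cmx A) / (1 - opnorm (Cmx A)) *
                enorm (x k.+1 - x k) &
              forall k : nat, enorm (u - x k.+1) <=
                opnorm (Cmx A) * enorm (u - x k)]].
Proof.
move=> m0 uA; set q := opnorm (Cmx A).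
have q1 : q < 1 by exact: opnorm_Cmx_lt1.
have q0 : 0 <= q by exact: opnorm_ge0.
pose f x := invmx (A^T *m A + 1%:M) *m
  (- ((A^T *m A - 1%:M) *m absv x) + 2 *: (A^T *m z)).
have stepf x : iter_step A z x (f x) by apply/iter_step_eq.
split=> [x|].
  by exists (f x); split=> // y /iter_step_eq ->.
have [u fu] : exists u, f u = u.
  apply: (enorm_contraction_fixpoint q0 q1) => x y.
  exact: iter_step_contraction m0 (stepf x) (stepf y).
have stepu : iter_step A z u u by rewrite -[X in iter_step _ _ _ X]fu.
have aveu : solves_ave A z u by apply/solves_ave_iter_step.
exists u; split=> // [v /solves_ave_iter_step stepv||x0].
- have /= := iter_step_contraction m0 stepv stepu => vu.
  apply/eqP; rewrite -subr_eq0; apply/eqP/enorm_eq0.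
  by have := enorm_ge0 (v - u); rewrite -/q in vu; nra.
- exact: metric_proj_simplicial_cone.
split; first by exists (fun k => iter k f x0); split.
move=> x [xx0 xS].
have lin k : enorm (u - x k.+1) <= q * enorm (u - x k).
  exact: iter_step_contraction m0 stepu (xS k).
split=> // [|k].
  have geo k : enorm (u - x k) <= enorm (u - x 0%N) * q ^+ k.
    elim: k => [|k IH]; first by rewrite mulr1.
    by rewrite (le_trans (lin k))// exprS mulrCA ler_wpM2l.
  have qk0 : enorm (u - x 0%N) * q ^+ k @[k --> \oo] --> (0 : R).
    by apply: cvg_geometric; rewrite ger0_norm.
  apply: (squeeze_cvgr _ (@cvg_cst R 0 _ _ _) qk0).
  by apply: nearW => k; rewrite enorm_ge0 geo.
(* Multiplied by 1 - q, the error bound combines the linear estimate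
   ||u - x_(k+1)|| <= q ||u - x_k|| with the triangle inequality. *)
rewrite mulrAC ler_pdivlMr ?subr_gt0//.
have tri : enorm (u - x k) <= enorm (u - x k.+1) + enorm (x k.+1 - x k).
  by rewrite -[u - x k](subrKA (x k.+1)) ler_enormD.
by have := lin k; nra.
Qed.
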